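(* For natural numbers $d\geq 2$ and $p\geq 1000d^2$, there exists an integer $n_0=n_0(d,p)$ such that the following holds. Let $G$ be an $(n,d,p)$-discrete graph with $n\geq n_0$. Then every orientation $D$ of $G$ satisfying $d^+_D(v)\neq d^-_D(v)$ for all $v\in V(D)$ is consistent.
   Context: Graphs are finite and simple. A graph $G$ is $(n,d,p)$-discrete if $|V(G)|=n$, $\Delta(G)\leq d$, and, letting $\mathcal{C}$ be the set of all cycles of $G$ of length at most $p$: (i) $|\mathcal{C}|\leq\log\log\log n$; (ii) $V(C)\cap V(C')=\emptyset$ for all distinct $C,C'\in\mathcal{C}$; (iii) $\mathrm{dist}_{G-\mathcal{C}}(u,v)\geq\log\log n$ for all distinct $u,v\in\bigcup_{C\in\mathcal{C}}V(C)$, where $G-\mathcal{C}$ is $G$ with all edges of cycles in $\mathcal{C}$ deleted. $\log$ is the natural logarithm. For a digraph $D$, $\mathrm{ex}(D)=\frac12\sum_v|d^+(v)-d^-(v)|$, and $D$ is consistent if its edge set can be partitioned into exactly $\mathrm{ex}(D)$ directed paths. *)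

(* Defs.v *)
From HB Require Import structures.
From mathcomp Require Import all_boot all_order all_algebra.
From mathcomp Require Import boolp classical_sets reals ereal exp.

Set Implicit Arguments.
Unset Strict Implicit.
Unset Printing Implicit Defensive.

Import Order.TTheory GRing.Theory Num.Theory.

Local Open Scope ring_scope.

(* A simple graph is a symmetric irreflexive relation on its vertex type; a
   digraph is an arbitrary relation. *)
Section Graphs.
Variable T : finType.
Implicit Types (e o : rel T) (C : {set {set T}}).

Definition simple_graph e : Prop := symmetric e /\ irreflexive e.

Definition max_degree e : nat := (\max_(v : T) #|[set w | e v w]%SET|)%N.

Definition edges_of_cycle (c : seq T) : {set {set T}} :=
  [set [set x; next c x] | x in c]%SET.

(* A cycle is identified with its edge set, so that rotations and reversals of
   a cyclic sequence are the same cycle, while distinct cycles may share their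
   vertex set. [ucycle e c] also holds for some sequences of size at most 2. *)
Definition is_cycle e C : Prop :=
  exists c : seq T, [/\ (3 <= size c)%N, ucycle e c & C = edges_of_cycle c].

Definition vertices_of_cycle C : {set T} := finset.cover C.

Definition short_cycles e (p : nat) : {set {set {set T}}} :=
  [set C | `[< is_cycle e C >] & (#|C| <= p)%N]%SET.

Definition delete_cycles e (CC : {set {set {set T}}}) : rel T :=
  [rel x y | e x y && ([set x; y]%SET \notin finset.cover CC)].

(* Infimum of the lengths of the u-v paths: +oo if there is none. *)
Definition dist (R : realType) e (u v : T) : \bar R :=
  ereal_inf [set ((size q)%:R)%:E |
    q in [set q : seq T | [/\ path e u q, uniq (u :: q) & last u q = v]]%classic
  ]%classic.

Definition discrete (R : realType) (n d p : nat) e : Prop :=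
  let CC := short_cycles e p in
  [/\ #|T| = n,
      (max_degree e <= d)%N,
      (#|CC|)%:R <= ln (ln (ln (n%:R : R))),
      forall C C', C \in CC -> C' \in CC -> C <> C' ->
        (vertices_of_cycle C :&: vertices_of_cycle C' = finset.set0)%SET
    & forall u v : T,
        u \in (\bigcup_(C in CC) vertices_of_cycle C)%SET ->
        v \in (\bigcup_(C in CC) vertices_of_cycle C)%SET ->
        u <> v ->
        ((ln (ln (n%:R : R)))%:E <= dist R (delete_cycles e CC) u v)%E].

Definition orientation e o : Prop :=
  (forall u v, e u v = o u v || o v u) /\
  (forall u v, ~~ (o u v && o v u)).

Definition outdeg o (v : T) : nat := #|[set w | o v w]%SET|.
Definition indeg o (v : T) : nat := #|[set w | o w v]%SET|.

Definition arcs o : {set T * T} := [set a | o a.1 a.2]%SET.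

Definition excess o : rat :=
  2^-1 * \sum_(v : T) `|(outdeg o v)%:R - (indeg o v)%:R|.

Definition is_dipath o (A : {set T * T}) : Prop :=
  exists s : seq T,
    [/\ uniq s, sorted o s & A = [set a in zip s (behead s)]%SET].

(* The blocks of a [finset.partition] are nonempty, so every path has an arc. *)
Definition consistent o : Prop :=
  exists P : {set {set T * T}},
    [/\ finset.partition P (arcs o),
        forall A, A \in P -> is_dipath o A
      & (#|P|)%:R = excess o].

End Graphs.

(* Main.v *)
Require Import Defs.
From mathcomp Require Import all_boot all_order all_algebra reals.
From mathcomp Require Import lra ring zify.
From mathcomp Require Import boolp ereal sequences exp.
From mathcomp Require classical_sets.

(** At every vertex [v] number the in-arcs and the out-arcs and choose a cyclic
shift modulo [max(d+(v), d-(v))]; it matches all arcs of the smaller side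
with arcs of the larger one, and following the matching cuts the digraph into
exactly [ex(D)] trails, all of them paths unless some directed cycle is followed
at all its vertices but at most one.  Each transition at [v] is realised by
exactly one shift.

Shifts avoiding all these events exist by Rosenfeld's counting argument: the
number of good partial choices grows by a factor [(1 - 1/(8d)) |A v|] with each
new vertex [v], where [A v] is the set of available shifts, provided that
the total weight of the cycles of length [> p] through [v] is small.  It is,
because a uniformly random transition at an unbalanced vertex loses a factor
[1 - 1/d] of mass in the forward direction if [d+ < d-] and in the backward
direction if [d- < d+], so closed walks of length [k] have total weight
[O(d (1 - 1/(2d))^k)].

On a cycle of length [<= p], two vertices get the shift following the cycle
excluded.  This at most doubles the weight of a transition there, and as
short cycles are disjoint and far apart, any [32 d] consecutive vertices of a path
contain at most two such vertices. *)

Set Implicit Arguments.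
Unset Strict Implicit.
Unset Printing Implicit Defensive.
Import Order.TTheory GRing.Theory Num.Theory.
Local Open Scope ring_scope.

(** * Avoiding events by counting *)

Section Counting.
Variables (R : realFieldType) (T : finType) (m : nat) (I : eqType).
Variables (A : T -> {set 'I_m.+1}) (sup : I -> {set T}) (value : I -> T -> 'I_m.+1).
Variables (Ev : T -> seq I) (beta : T -> R).
Hypothesis beta_gt0 : forall v, 0 < beta v.
Hypothesis Ev_sup : forall v i, i \in Ev v -> v \in sup i.
(** An event is listed at every vertex of its support, under an index that may depend on the vertex;
    only the support and the values on it have to agree. *)
Hypothesis Ev_cover : forall v u i, i \in Ev v -> u \in sup i ->
  exists j, [/\ j \in Ev u, sup j = sup i & {in sup i, value j =1 value i}].
(** Rosenfeld's condition: [beta v] is the growth factor to be proved when [v] is added, and the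
    product bounds, relative to [good S], the number of extensions killed by the event [i]. *)
Hypothesis beta_le : forall v,
  beta v + \sum_(i <- Ev v) \prod_(u in sup i :\ v) (beta u)^-1 <= #|A v|%:R.

Implicit Types (w : {ffun T -> 'I_m.+1}) (S X : {set T}).

Definition holds i w := [forall u in sup i, w u == value i u].

Definition good S : {set {ffun T -> 'I_m.+1}} :=
  [set w : {ffun T -> 'I_m.+1} |
    [forall u, if u \in S then w u \in A u else w u == ord0] &&
    [forall v in S, all (fun i => (sup i \subset S) ==> ~~ holds i w) (Ev v)]].

Definition restrict S w : {ffun T -> 'I_m.+1} :=
  [ffun u => if u \in S then w u else ord0].

Definition set_at v (wa : {ffun T -> 'I_m.+1} * 'I_m.+1) : {ffun T -> 'I_m.+1} :=
  [ffun u => if u == v then wa.2 else wa.1 u].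

Lemma goodP S w : reflect
  [/\ forall u, u \in S -> w u \in A u,
      forall u, u \notin S -> w u = ord0 &
      forall v i, v \in S -> i \in Ev v -> sup i \subset S -> ~~ holds i w]
  (w \in good S).
Proof.
rewrite inE; apply: (iffP andP) => [[/forallP h1 /forall_inP h2]|[h1 h2 h3]]; split.
- by move=> u uS; have := h1 u; rewrite uS.
- by move=> u uS; have := h1 u; rewrite (negbTE uS) => /eqP.
- by move=> v i vS iE sS; have /allP /(_ i iE) := h2 v vS; rewrite sS.
- by apply/forallP => u; case: ifPn => uS; [exact: h1 | rewrite h2].
- by apply/forall_inP => v vS; apply/allP => i iE; apply/implyP; exact: h3 iE.
Qed.

Lemma eq_holds i w w' : {in sup i, w =1 w'} -> holds i w = holds i w'.
Proof.
by move=> e; apply: eq_forallb_in => u uS; rewrite e.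
Qed.

Lemma restrict_good S X w : X \subset S -> w \in good S -> restrict X w \in good X.
Proof.
move=> XS /goodP [h1 h2 h3]; apply/goodP; split.
- by move=> u uX; rewrite ffunE uX h1 // (subsetP XS).
- by move=> u uX; rewrite ffunE (negbTE uX).
- move=> v i vX iE sX; rewrite (@eq_holds i _ w); last first.
    by move=> u us; rewrite ffunE (subsetP sX).
  by apply: h3 iE _; [exact: (subsetP XS) | exact: subset_trans sX XS].
Qed.

Lemma restrict_set_at S X v w a : v \notin S -> w \in good S ->
  restrict (S :\: X) (set_at v (w, a)) \in good (S :\: X).
Proof.
move=> vS wS.
have -> : restrict (S :\: X) (set_at v (w, a)) = restrict (S :\: X) w.
  apply/ffunP => u; rewrite !ffunE; case: ifPn => //; rewrite inE => /andP[_ uS].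
  by case: eqP uS vS => // ->  ->.
by apply: restrict_good wS; exact: subsetDl.
Qed.

Lemma card_holds S v i : v \notin S -> i \in Ev v ->
  (#|[set w in set_at v @: setX (good S) (A v) | holds i w]| <= #|good (S :\: sup i)|)%N.
Proof.
move=> vS iE; rewrite -(card_in_imset (f := restrict (S :\: sup i))).
  apply: subset_leq_card; apply/subsetP => _ /imsetP [_ /setIdP[/imsetP[[w a] wa ->] h] ->].
  by have /setXP[/= wG _] := wa; exact: restrict_set_at.
move=> _ _ /setIdP[/imsetP[[w a] wa ->] /forall_inP h]
  /setIdP[/imsetP[[w' a'] wa' ->] /forall_inP h'] /ffunP E.
apply/ffunP => u; case: (boolP (u \in sup i)) => us.
  by rewrite (eqP (h u us)) (eqP (h' u us)).
have := E u; rewrite !ffunE inE us /=.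
case: (boolP (u \in S)) => // uS _.
case: eqP us => [->|_ us]; first by rewrite Ev_sup.
by have /setXP[/= /goodP[_ -> // _] _] := wa; have /setXP[/= /goodP[_ -> // _] _] := wa'.
Qed.

(** An event that spoils an extension must pass through [v], since otherwise its support lies in [S]
    and it already spoils the restriction. By [Ev_cover] it is then listed at [v] itself. *)
Lemma good_step_set S v : v \notin S ->
  set_at v @: setX (good S) (A v) :\: good (v |: S) \subset
  \bigcup_(i <- Ev v | sup i \subset v |: S)
     [set w in set_at v @: setX (good S) (A v) | holds i w].
Proof.
move=> vS; apply/subsetP => w0 /setDP[w0I w0N].
have [[w a] /setXP[/= wG aA] Ew] := imsetP w0I.
suff [i [iE sS hi]] : exists i, [/\ i \in Ev v, sup i \subset v |: S & holds i w0].
  elim: (Ev v) iE => // j s IH; rewrite in_cons big_cons => /orP[/eqP <-|/IH {}IH].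
    by rewrite sS inE; apply/orP; left; rewrite inE w0I.
  by case: ifP => // _; rewrite inE IH orbT.
case: (boolP (has (fun i => (sup i \subset v |: S) && holds i w0) (Ev v))).
  by case/hasP => i iE /andP[? ?]; exists i.
move=> /hasPn nE; case/negP: w0N; have [h1 h2 h3] := goodP _ _ wG.
have w0E u : w0 u = if u == v then a else w u by rewrite Ew ffunE.
apply/goodP; split.
- move=> u; rewrite !inE w0E; case: eqP => [-> //|_ /= uS]; exact: h1.
- move=> u; rewrite !inE w0E; case: eqP => //= _; exact: h2.
move=> u i uS iE sS; case: (boolP (v \in sup i)) => vi.
  have [j [jE sj vj]] := Ev_cover iE vi.
  have := nE j jE; rewrite sj sS /=; congr (~~ _).
  by rewrite /holds sj; apply: eq_forallb_in => x xs; rewrite vj.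
have uv : u != v by apply: contraNneq vi => <-; exact: Ev_sup iE.
rewrite (@eq_holds i _ w); last first.
  by move=> x xs; rewrite w0E; case: eqP xs vi => // -> ->.
apply: h3 iE _; first by move: uS; rewrite !inE (negbTE uv).
apply/subsetP => x xs; have := subsetP sS x xs; rewrite !inE.
by case: eqP xs vi => // -> ->.
Qed.

Lemma set_at_card S v : v \notin S ->
  #|set_at v @: setX (good S) (A v)| = (#|good S| * #|A v|)%N.
Proof.
move=> vS; rewrite card_in_imset ?cardsX //.
move=> [w a] [w' a'] /setXP[/= /goodP[_ h _] _] /setXP[/= /goodP[_ h' _] _] /ffunP E.
congr (_, _); last by have := E v; rewrite !ffunE eqxx.
apply/ffunP => u; have := E u; rewrite !ffunE /=; case: eqP => // -> _.
by rewrite h ?h'.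
Qed.

Lemma card_bigcup_seq (J : Type) (X : finType) (r : seq J) (P : pred J) (F : J -> {set X}) :
  (#|\bigcup_(i <- r | P i) F i| <= \sum_(i <- r | P i) #|F i|)%N.
Proof.
elim/big_ind2: _ => [|x1 n1 x2 n2 h1 h2|//]; first by rewrite cards0.
by apply: leq_trans (leq_card_setU _ _) _; exact: leq_add.
Qed.

(* Removing the elements of [X] one at a time, each removal being an instance of
   the growth inequality of [good_step] for a smaller set. *)
Lemma good_prod S X n : (forall S' v, (#|S'| < n)%N -> v \notin S' ->
    beta v * #|good S'|%:R <= #|good (v |: S')|%:R) ->
  X \subset S -> (#|S| <= n)%N ->
  #|good (S :\: X)|%:R <= #|good S|%:R * \prod_(u in X) (beta u)^-1.
Proof.
move=> IH; elim: {X}#|X| {-2}X (erefl #|X|) => [|k IHk] X.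
  by move/eqP; rewrite cards_eq0 => /eqP -> _ _; rewrite setD0 big_set0 mulr1.
move=> cX XS Sn; have /card_gt0P[x xX] : (0 < #|X|)%N by rewrite cX.
have h := IHk (X :\ x).
have cX' : #|X :\ x| = k by move: cX; rewrite (cardsD1 x) xX add1n => -[].
have := h cX' (subset_trans (subD1set _ _) XS) Sn.
have xS : x \in S := subsetP XS x xX.
have -> : S :\: (X :\ x) = x |: (S :\: X).
  by apply/setP => u; rewrite !inE; case: eqP => [->|] //=; rewrite xS.
rewrite [in X in _ -> X](big_setD1 x xX) /=.
have := IH (S :\: X) x; rewrite inE xX /=.
have -> : (#|S :\: X| < n)%N.
  apply: leq_trans Sn; apply: proper_card; apply/properP.
  by split; [exact: subsetDl | exists x => //; rewrite inE xX].
move=> /(_ isT isT); set a := #|good _|%:R; set b := #|good _|%:R; set c := #|good S|%:R.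
set pr := \prod_(_ in _) _ => h1 h2.
rewrite mulrCA -ler_pdivrMl ?invr_gt0 // invrK; exact: le_trans h1 h2.
Qed.

(* Of the [#|good S| * #|A v|] extensions to [v], those killed by the event [i]
   are determined by their restriction to [S :\: sup i]. *)
Lemma good_step n S v : (#|S| < n)%N -> v \notin S ->
  beta v * #|good S|%:R <= #|good (v |: S)|%:R.
Proof.
elim: n S v => // n IH S v Sn vS.
set H := set_at v @: setX (good S) (A v).
have cH : (#|H| <= #|good (v |: S)| +
   \sum_(i <- Ev v | sup i \subset v |: S) #|[set w in H | holds i w]|)%N.
  rewrite -(cardsID (good (v |: S)) H); apply: leq_add.
    by apply: subset_leq_card; exact: subsetIr.
  by apply: leq_trans (card_bigcup_seq _ _ _); apply: subset_leq_card; exact: good_step_set.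
have : (#|H|%:R : R) <= #|good (v |: S)|%:R +
   #|good S|%:R * \sum_(i <- Ev v) \prod_(u in sup i :\ v) (beta u)^-1.
  apply: (@le_trans _ _ (#|good (v |: S)|%:R +
     (\sum_(i <- Ev v | sup i \subset v |: S) #|[set w in H | holds i w]|)%:R)).
    by rewrite -natrD ler_nat.
  rewrite lerD2l natr_sum mulr_sumr big_mkcond /=.
  rewrite [leLHS]big_seq [leRHS]big_seq; apply: ler_sum => i iE.
  case: ifPn => sS; last first.
    by apply: mulr_ge0 => //; apply: prodr_ge0 => u _; rewrite invr_ge0 ltW.
  have sS' : sup i :\ v \subset S.
    apply/subsetP => u; rewrite !inE => /andP[uv us].
    by have := subsetP sS u us; rewrite !inE (negbTE uv).
  apply: le_trans (good_prod (n := n) _ sS' _) => //.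
  have -> : S :\: (sup i :\ v) = S :\: sup i.
    apply/setP => u; rewrite !inE; case: eqP => [->|//].
    by rewrite (negbTE vS) !andbF.
  by rewrite ler_nat; exact: card_holds.
rewrite set_at_card // natrM; set g := #|good S|%:R; set s := \sum_(i <- _) _.
have := beta_le v; rewrite -/s => h1 h2.
have g0 : 0 <= g by rewrite /g ler0n.
have := ler_wpM2l g0 h1; rewrite mulrDr [g * beta v]mulrC; lra.
Qed.

Lemma good_gt0 S : (0 < #|good S|)%N.
Proof.
elim: {S}#|S| {-2}S (erefl #|S|) => [|k IHk] S.
  move/eqP; rewrite cards_eq0 => /eqP ->; apply/card_gt0P; exists [ffun=> ord0].
  by apply/goodP; split => [u|u _|u i]; rewrite ?ffunE // inE.
move=> cS; have /card_gt0P[x xS] : (0 < #|S|)%N by rewrite cS.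
have cS' : #|S :\ x| = k by move: cS; rewrite (cardsD1 x) xS add1n => -[].
rewrite -(@ltr_nat R) -(setD1K xS); apply: lt_le_trans (@good_step k.+1 _ _ _ _).
- by rewrite mulr_gt0 ?ltr0n ?IHk.
- by rewrite cS'.
- by rewrite !inE eqxx.
Qed.

Lemma exists_avoiding : exists w : {ffun T -> 'I_m.+1},
  (forall v, w v \in A v) /\ (forall v i, i \in Ev v -> exists2 u, u \in sup i & w u != value i u).
Proof.
have /card_gt0P[w /goodP[h1 _ h3]] := good_gt0 setT.
exists w; split=> [v|v i iE]; first exact: h1.
have := h3 v i (in_setT _) iE (subsetT _); rewrite /holds negb_forall_in.
by case/existsP => u /andP[? ?]; exists u.
Qed.
End Counting.

(** * Path decompositions from transitions *)

Section Decomposition.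
Variables (T : finType) (o : rel T) (lk : T -> T -> T -> bool).

Fixpoint linked x y s :=
  if s is z :: s' then lk x y z && linked y z s' else true.

Hypothesis o_irr : forall x, ~~ o x x.
Hypothesis lk_o : forall x v y, lk x v y -> o x v /\ o v y.
Hypothesis lk_fun : forall x v y y', lk x v y -> lk x v y' -> y = y'.
Hypothesis lk_inj : forall x x' v y, lk x v y -> lk x' v y -> x = x'.
Hypothesis lk_out : forall v x, (indeg o v < outdeg o v)%N -> o x v -> exists y, lk x v y.
Hypothesis lk_in : forall v y, (outdeg o v < indeg o v)%N -> o v y -> exists x, lk x v y.
Hypothesis o_unbal : forall v, outdeg o v <> indeg o v.
(** The walk goes once round a cycle from [x] back to [x], and [linked] tests all its transitions
    except the one at [x]: a trail could start and end there without making it. *)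
Hypothesis lk_acyclic : forall x y s,
  uniq [:: x, y & s] -> o x y -> ~~ linked x y (rcons s x).

Definition next_arc : rel (T * T) := [rel a b | (a.2 == b.1) && lk a.1 a.2 b.2].
Local Notation g := next_arc.

Definition terminal : {set T * T} :=
  [set a in arcs o | ~~ [exists z, lk a.1 a.2 z]].

(* The trail whose last arc is [b], when [b] is terminal. *)
Definition trail_to b : {set T * T} := [set a in arcs o | connect g a b].

Lemma next_arc_arcs a b : g a b -> a \in arcs o /\ b \in arcs o.
Proof. by rewrite !inE => /andP[/eqP <- /lk_o[? ?]]. Qed.

Lemma path_linked a q : path g a q -> linked a.1 a.2 [seq b.2 | b <- q].
Proof.
elim: q a => //= b q IH a /andP[/andP[/eqP e l] /IH]; rewrite l /= e.
by [].
Qed.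

Lemma linked_catl x y s s' : linked x y (s ++ s') -> linked x y s.
Proof. by elim: s x y => //= z s IH x y /andP[-> /IH]. Qed.

(** By induction the vertices after the first are distinct. If the first one reappears, cutting the
    trail there leaves a cycle followed at all vertices but [a.1], against [lk_acyclic]. *)
Lemma trail_uniq a q : a \in arcs o -> path g a q -> uniq [:: a.1, a.2 & [seq b.2 | b <- q]].
Proof.
elim: q a => [|b q IH] a ao pq.
  rewrite /= inE andbT; move: ao; rewrite inE; apply: contraTN => /eqP ->; exact: o_irr.
have /andP[gab pbq] := pq; have [_ bo] := next_arc_arcs gab.
have /andP[/eqP e _] := gab.
have U : uniq (a.2 :: [seq c.2 | c <- b :: q]) by rewrite e; exact: IH.
suff h : a.1 \notin a.2 :: [seq c.2 | c <- b :: q] by rewrite cons_uniq h.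
rewrite in_cons negb_or; apply/andP; split.
  by move: ao; rewrite inE; apply: contraTneq => ->; exact: o_irr.
apply/negP => /mapP [c cq ac]; move: (b :: q) cq U pq => q' cq.
case: (splitPr cq) => q1 q2; rewrite map_cat map_cons -ac => U pq.
have U' : uniq [:: a.1, a.2 & [seq b.2 | b <- q1]].
  move: U; rewrite -cat_cons uniq_catC cat_cons cons_uniq mem_cat negb_or.
  by rewrite (cons_uniq a.1 (a.2 :: _)) uniq_catC cat_uniq => /andP[/andP[_ ->]] /and3P[-> _ _].
have := lk_acyclic U'; rewrite inE in ao => /(_ ao) /negP; apply.
have := path_linked pq; rewrite map_cat /= -ac -cat_rcons.
exact: linked_catl.
Qed.

Lemma trail_size a q : a \in arcs o -> path g a q -> (size q < #|T|)%N.
Proof.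
move=> ao pq; have := card_uniqP (trail_uniq ao pq); rewrite /= size_map => e.
by apply: leq_trans (max_card (mem [:: a.1, a.2 & [seq b.2 | b <- q]])); rewrite e.
Qed.

Lemma terminal_exists a : a \in arcs o -> exists2 b, b \in terminal & connect g a b.
Proof.
(* [n] is fuel: the trail is prolonged while it can be, and [trail_size] forbids it to reach [#|T|]
   further arcs. *)
move=> ao; suff H n q : path g a q -> (#|T| <= size q + n)%N ->
    exists2 b, b \in terminal & connect g a b by exact: (H #|T| [::]).
elim: n q => [|n IH] q pq; first by rewrite addn0 leqNgt (trail_size ao pq).
move=> sz; have cq : connect g a (last a q) by apply/connectP; exists q.
case: (boolP [exists z, lk (last a q).1 (last a q).2 z]) => [/existsP[z lz]|nz].
  apply: (IH (rcons q ((last a q).2, z))); last by rewrite size_rcons addSnnS.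
  by rewrite rcons_path pq /next_arc /= eqxx.
exists (last a q) => //; rewrite inE nz andbT.
case/lastP: q pq {sz cq nz} => // q c; rewrite rcons_path last_rcons => /andP[_ h].
by case: (next_arc_arcs h).
Qed.

Lemma initial_exists b : b \in arcs o -> exists a q,
  [/\ a \in arcs o, path g a q, last a q = b & forall c, ~~ g c a].
Proof.
move=> bo; suff H n a q : a \in arcs o -> path g a q -> last a q = b ->
    (#|T| <= size q + n)%N -> exists a q,
    [/\ a \in arcs o, path g a q, last a q = b & forall c, ~~ g c a].
  exact: (H #|T| b [::]).
elim: n a q => [|n IH] a q ao pq; first by rewrite addn0 leqNgt (trail_size ao pq).
move=> lq sz; case: (boolP [exists c, g c a]) => [/existsP[c gc]|/existsPn nc].
  have [co _] := next_arc_arcs gc.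
  by apply: (IH c (a :: q)) => //=; rewrite ?gc // addSnnS.
by exists a, q.
Qed.

Lemma trail_zip a q : path g a q ->
  zip (a.1 :: [seq b.2 | b <- a :: q]) [seq b.2 | b <- a :: q] = a :: q.
Proof.
elim: q a => [|b q IH] [a1 a2] //= /andP[/andP[/= /eqP e _] /IH].
by rewrite /= e => ->.
Qed.

(** An arc has at most one predecessor, by [lk_inj]. Hence a path started at an arc without
    predecessor contains every arc that leads to one of its members, and so exhausts [trail_to]. *)
Lemma path_mem_pred a q b c : path g a q -> (forall c, ~~ g c a) ->
  b \in a :: q -> g c b -> c \in a :: q.
Proof.
move=> pq ini; rewrite inE => /orP[/eqP -> gc|bq]; first by have := ini c; rewrite gc.
case: (splitPr bq) pq => q1 q2; rewrite cat_path /= => /and3P[_ gl _] gcb.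
suff -> : c = last a q1 by rewrite -cat_cons mem_cat mem_last.
move: gl gcb => /andP[/eqP e1 l1] /andP[/eqP e2 l2].
rewrite [c]surjective_pairing [last a q1]surjective_pairing e1 e2; congr (_, _).
by rewrite e1 in l1; rewrite e2 in l2; exact: lk_inj l2 l1.
Qed.

Lemma trail_dipath b : b \in arcs o -> is_dipath o (trail_to b).
Proof.
move=> bo; have [a [q [ao pq lq ini]]] := initial_exists bo.
exists (a.1 :: [seq b.2 | b <- a :: q]); split.
- exact: trail_uniq ao pq.
- move=> {lq ini}; elim: q a ao pq => [|c q IH] a; rewrite inE /= => -> //.
  move=> /andP[gac pq]; have [_ co] := next_arc_arcs gac.
  by have := IH c co pq; have /andP[/eqP <- _] := gac.
rewrite trail_zip //; apply/setP => c; rewrite [RHS]in_set; apply/setIdP/idP.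
  case=> co /connectP [q' pq' lq'].
  elim: q' c co pq' lq' => [|c' q' IH] c co /=.
    by move=> _ <-; rewrite -lq mem_last.
  move=> /andP[gc pq'] l'; have [_ c'o] := next_arc_arcs gc.
  by apply: path_mem_pred gc => //; apply: IH.
move=> cq; split.
  move: cq; rewrite inE => /orP[/eqP -> //|cq].
  case: (splitPr cq) pq => q1 q2; rewrite cat_path /= => /and3P[_ h _].
  by have [] := next_arc_arcs h.
move: cq; rewrite inE => /orP[/eqP ->|cq].
  by apply/connectP; exists q.
case: (splitPr cq) pq lq => q1 q2; rewrite cat_path last_cat /= => /and3P[_ _ pq] lq.
by apply/connectP; exists q2.
Qed.

Lemma terminal_uniq a b b' : b \in terminal -> b' \in terminal ->
  connect g a b -> connect g a b' -> b = b'.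
Proof.
move=> /setIdP[_ tb] /setIdP[_ tb'] /connectP[q pq eb] /connectP[q' pq' eb'].
move: tb tb'; rewrite {b}eb {b'}eb' => tb tb'.
elim: q a q' pq pq' tb tb' => [|c q IH] a [|c' q'] //=.
- by move=> _ /andP[/andP[_ l] _] /existsPn /(_ c'.2); rewrite l.
- by move=> /andP[/andP[_ l] _] _ _ /existsPn /(_ c.2); rewrite l.
move=> /andP[/andP[/eqP e l] pq] /andP[/andP[/eqP e' l'] pq'].
suff cc : c' = c by rewrite cc in pq' *; exact: IH.
by rewrite [c]surjective_pairing [c']surjective_pairing -e -e' (lk_fun l l').
Qed.

Lemma arcs_partition : finset.partition (trail_to @: terminal) (arcs o).
Proof.
apply/and3P; split.
- rewrite finset.cover_imset; apply/eqP/setP => a; apply/bigcupP/idP.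
    by case=> b _; rewrite inE => /andP[].
  by move=> ao; have [b tb cab] := terminal_exists ao; exists b => //; rewrite inE ao.
- apply/finset.trivIsetP => _ _ /imsetP[b tb ->] /imsetP[b' tb' ->] ne.
  rewrite -setI_eq0; apply/eqP/setP => a; rewrite inE in_set0; apply/negP.
  move=> /andP[/setIdP[_ c] /setIdP[_ c']]; case/eqP: ne.
  by rewrite (terminal_uniq tb tb' c c').
- apply/imsetP => -[b tb] /setP /(_ b); rewrite in_set0 inE connect0 andbT.
  by have /setIdP[->] := tb.
Qed.

Lemma card_trails : #|trail_to @: terminal| = #|terminal|.
Proof.
apply: card_in_imset => b b' tb tb' /setP /(_ b).
have /setIdP[bo _] := tb; rewrite !inE connect0 andbT.
rewrite inE in bo; rewrite bo /= => /esym h.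
by apply: (terminal_uniq tb tb' _ h); exact: connect0.
Qed.

(** This counts the trails ending at [v]. If the out-degree is larger, every in-arc is continued; if
    the in-degree is larger, the out-arcs are matched with as many in-arcs and the remaining ones
    stop. *)
Lemma card_unlinked v :
  #|[set x | o x v & ~~ [exists z, lk x v z]]| = (indeg o v - outdeg o v)%N.
Proof.
case: (ltngtP (indeg o v) (outdeg o v)) => [lt|lt|e]; last by case: (@o_unbal v).
  rewrite (eqP (ltnW lt)); apply/eqP; rewrite cards_eq0; apply/eqP/setP => x.
  rewrite !inE; case: (boolP (o x v)) => //= ov; apply/negbF/existsP; exact: lk_out.
have <- : #|[set x | o x v & [exists z, lk x v z]]| = outdeg o v.
  pose f z := odflt v [pick x | lk x v z].
  have fP z : o v z -> lk (f z) v z.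
    rewrite /f; case: pickP => //= h ov; have [x] := lk_in lt ov; by rewrite h.
  have <- : f @: [set z | o v z] = [set x | o x v & [exists z, lk x v z]].
    apply/setP => x; apply/imsetP/idP.
      case=> z; rewrite inE => /fP lz ->; rewrite inE (lk_o lz).1 /=.
      by apply/existsP; exists z.
    rewrite inE => /andP[_ /existsP[z lz]]; have [_ oz] := lk_o lz.
    by exists z; rewrite ?inE //; exact: lk_inj lz (fP _ oz).
  rewrite card_in_imset // => z z'; rewrite !inE => /fP lz /fP lz' e.
  by rewrite e in lz; exact: lk_fun lz lz'.
rewrite /indeg -(cardsID [set x | [exists z, lk x v z]] [set w | o w v]).
have -> : [set w | o w v] :&: [set x | [exists z, lk x v z]] =
  [set x | o x v & [exists z, lk x v z]] by apply/setP => x; rewrite !inE.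
rewrite addKn; apply: eq_card => x; rewrite !inE; exact: andbC.
Qed.

Lemma card_terminal : #|terminal| = (\sum_v (indeg o v - outdeg o v))%N.
Proof.
rewrite -sum1_card.
under [RHS]eq_bigr do rewrite -card_unlinked -sum1_card.
rewrite (exchange_big_dep predT) //= pair_big_dep /=.
by apply: eq_bigl => -[x v]; rewrite !inE /=.
Qed.

Lemma sum_outdeg_indeg : (\sum_v outdeg o v = \sum_v indeg o v)%N.
Proof.
under eq_bigr do rewrite /outdeg -sum1_card.
under [RHS]eq_bigr do rewrite /indeg -sum1_card.
rewrite (exchange_big_dep predT) //=; apply: eq_bigr => v _.
by apply: eq_bigl => x; rewrite !inE.
Qed.

Lemma excess_terminal : #|terminal|%:R = excess o.
Proof.
(* The absolute value is the signed difference plus twice its negative part; the signed differences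
   sum to zero over all vertices. *)
have E v : `|(outdeg o v)%:R - (indeg o v)%:R| =
   ((outdeg o v)%:R - (indeg o v)%:R) + 2 * (indeg o v - outdeg o v)%:R :> rat.
  case: (leqP (indeg o v) (outdeg o v)) => h.
    by rewrite (eqP h) mulr0 addr0 ger0_norm // subr_ge0 ler_nat.
  by rewrite natrB ?(ltnW h) // ltr0_norm ?subr_lt0 ?ltr_nat //; lra.
rewrite /excess (eq_bigr _ (fun v _ => E v)) big_split /= sumrB -!natr_sum.
rewrite sum_outdeg_indeg subrr add0r -mulr_sumr -natr_sum card_terminal; lra.
Qed.

Lemma linked_consistent : consistent o.
Proof.
exists (trail_to @: terminal); split; first exact: arcs_partition.
  by move=> _ /imsetP[b /setIdP[bo _] ->]; exact: trail_dipath.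
by rewrite card_trails excess_terminal.
Qed.
End Decomposition.

(** * Weighted closed walks *)

Section Walks.
Variables (R : realFieldType) (T : finType) (o : rel T).

(** Only interior vertices are listed: [walks k v v] gives the closed walks with [k + 1] arcs, whose
    two ends at [v] are not weighted. *)
Fixpoint walks k v z : seq (seq T) :=
  if k is k'.+1 then
    flatten [seq [seq w :: t | t <- walks k' w z] | w <- enum T & o v w]
  else if o v z then [:: [::]] else [::].

Lemma mem_walks k v z t : (t \in walks k v z) = (size t == k) && path o v (rcons t z).
Proof.
elim: k v t => [|k IH] v t /=.
  by case: ifP => ov; case: t => [|a t] //=; rewrite ov.
apply/flatten_mapP/andP.
  case=> w; rewrite mem_filter => /andP[ov _] /mapP[t' t'k ->].
  by move: t'k; rewrite IH => /andP[/eqP <- pt] /=; rewrite ov.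
case: t => [[]//|w t] /= [] sz /andP[ov pt]; exists w; first by rewrite mem_filter ov mem_enum.
by apply: map_f; rewrite IH pt andbT.
Qed.

Variable h : T -> R.
Definition walk_sum k v z : R := \sum_(t <- walks k v z) \prod_(u <- t) h u.

Lemma walk_sum0 v z : walk_sum 0 v z = (o v z)%:R.
Proof. by rewrite /walk_sum /=; case: (o v z); rewrite ?big_seq1 !big_nil. Qed.

Lemma walk_sumS k v z : walk_sum k.+1 v z = \sum_(w | o v w) h w * walk_sum k w z.
Proof.
rewrite /walk_sum /= big_flatten /= big_map big_filter big_enum_cond /=.
apply: eq_bigr => w _; rewrite big_map mulr_sumr; apply: eq_bigr => t _.
by rewrite big_cons.
Qed.

Lemma walk_sumSr k v z : walk_sum k.+1 v z = \sum_(w | o w z) walk_sum k v w * h w.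
Proof.
elim: k v => [|k IH] v.
  rewrite walk_sumS [LHS]big_mkcond [RHS]big_mkcond /=; apply: eq_bigr => w _.
  by rewrite !walk_sum0; case: (o v w); case: (o w z); rewrite ?mul0r ?mulr0 ?mul1r ?mulr1.
rewrite walk_sumS; under eq_bigr do rewrite IH mulr_sumr.
rewrite exchange_big /=; apply: eq_bigr => w _; rewrite walk_sumS mulr_suml.
by apply: eq_bigr => u _; rewrite mulrA.
Qed.

Hypothesis h_ge0 : forall u, 0 <= h u.

(** The hypothesis makes [h] substochastic for forward steps, so mass does not grow along the walk;
    the first step, being unweighted, leaves the factor [outdeg o v]. *)
Lemma walk_sum_le_out k v z : (forall u, h u * (outdeg o u)%:R <= 1) ->
  walk_sum k v z <= (outdeg o v)%:R.
Proof.
move=> ho; elim: k v => [|k IH] v.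
  rewrite walk_sum0 ler_nat; case: (boolP (o v z)) => //= ov.
  by apply/card_gt0P; exists z; rewrite inE.
rewrite walk_sumS /outdeg -sum1_card natr_sum.
under [leRHS]eq_bigl do rewrite inE.
by apply: ler_sum => w _; apply: le_trans (ho w); exact: ler_wpM2l.
Qed.

Lemma walk_sum_le_in k v z : (forall u, h u * (indeg o u)%:R <= 1) ->
  walk_sum k v z <= (indeg o z)%:R.
Proof.
move=> ho; elim: k z => [|k IH] z.
  rewrite walk_sum0 ler_nat; case: (boolP (o v z)) => //= ov.
  by apply/card_gt0P; exists v; rewrite inE.
rewrite walk_sumSr /indeg -sum1_card natr_sum.
under [leRHS]eq_bigl do rewrite inE.
apply: ler_sum => w _; apply: le_trans (ho w); rewrite mulrC; exact: ler_wpM2l.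
Qed.
End Walks.

(** * Exponential decay of the weight of closed walks at unbalanced vertices *)

Section WalkDecay.
Variables (R : realFieldType) (T : finType) (o : rel T) (d : nat).
Hypothesis d_gt0 : (0 < d)%N.
Hypothesis out_le : forall v, (outdeg o v <= d)%N.
Hypothesis in_le : forall v, (indeg o v <= d)%N.
Hypothesis o_unbal : forall v, outdeg o v <> indeg o v.

(* The number of cyclic shifts matching the in-arcs of [v] with its out-arcs. *)
Definition width v := maxn (outdeg o v) (indeg o v).

Lemma width_gt0 v : (0 < width v)%N.
Proof.
rewrite lt0n; apply/eqP => w0; case: (@o_unbal v).
have := leq_maxl (outdeg o v) (indeg o v); have := leq_maxr (outdeg o v) (indeg o v).
by rewrite -/(width v) w0 !leqn0 => /eqP-> /eqP->.
Qed.

Lemma width_le v : (width v <= d)%N.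
Proof. by rewrite geq_max out_le in_le. Qed.

Definition decay : R := 1 - (2 * d%:R)^-1.
Local Notation q := decay.

Lemma decay_gt0 : 0 < q.
Proof.
have d1 : (1 : R) <= d%:R by rewrite ler1n.
by rewrite /q subr_gt0 invf_lt1; lra.
Qed.

(** An integer below [width v <= d] is at most [(1 - 1/d) * width v], and [q ^+ 2 >= 1 - 1/d]. So
    the smaller side of an unbalanced vertex has room for a factor [q^-2]. *)
Lemma width_decay n v : (n < width v)%N -> (width v)%:R^-1 * q^-2 * n%:R <= 1 :> R.
Proof.
move=> nw; have q0 := decay_gt0; have w0 : (0 : R) < (width v)%:R by rewrite ltr0n width_gt0.
have d0 : (0 : R) < d%:R by rewrite ltr0n.
rewrite mulrAC ler_pdivrMr ?exprn_gt0 // mul1r ler_pdivrMl //.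
have n1 : n%:R + 1 <= (width v)%:R :> R by rewrite natr1 ler_nat.
have wd : (width v)%:R * d%:R^-1 <= 1 :> R by rewrite ler_pdivrMr // mul1r ler_nat width_le.
have q2 : 1 - d%:R^-1 <= q ^+ 2.
  by rewrite /q invfM; set x := _^-1; have := sqr_ge0 x; lra.
have := ler_wpM2l (ltW w0) q2; lra.
Qed.

(* The two weights have product [q^-2] at each vertex, so that after
   multiplication by [q ^+ size t] the two products are inverse to each other
   and at least one of them is [>= 1]. *)
Lemma prod_width_le (t : seq T) :
  \prod_(u <- t) (width u)%:R^-1 <= q ^+ size t *
   (\prod_(u <- t) ((width u)%:R^-1 * (if (outdeg o u < indeg o u)%N then q^-2 else 1)) +
    \prod_(u <- t) ((width u)%:R^-1 * (if (outdeg o u < indeg o u)%N then 1 else q^-2))).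
Proof.
rewrite !big_split /= -mulrDr mulrCA; have q0 := decay_gt0.
rewrite ler_peMr //; first by apply: prodr_ge0 => u _; rewrite invr_ge0.
set x := \prod_(u <- t) _; set y := \prod_(u <- t) _.
have xy : (q ^+ size t * x) * (q ^+ size t * y) = 1.
  rewrite mulrACA -exprMn -big_split /= (eq_bigr (fun=> q^-2)); last first.
    by move=> u _; case: ifP => _; rewrite ?mulr1 ?mul1r.
  rewrite big_const_seq count_predT iter_mulr_1 -exprMn -expr2 divff ?expr1n //.
  by rewrite expf_neq0 // gt_eqF.
have x0 : 0 < x by apply: prodr_gt0 => u _; case: ifP => // _; rewrite invr_gt0 exprn_gt0.
have X0 : 0 < q ^+ size t * x by rewrite mulr_gt0 ?exprn_gt0.
have y0 : 0 < y by apply: prodr_gt0 => u _; case: ifP => // _; rewrite invr_gt0 exprn_gt0.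
have Y0 : 0 < q ^+ size t * y by rewrite mulr_gt0 ?exprn_gt0.
rewrite mulrDr; move: X0 Y0 xy; move: (_ * x) (_ * y) => X Y X0 Y0 XY.
nra.
Qed.

(** Of the two weights in [prod_width_le], the first has [q^-2] where the out-degree is smaller and
    is substochastic forwards; the second is so backwards. Each contributes at most [d]. *)
Lemma closed_walks_le k v :
  \sum_(t <- walks o k v v) \prod_(u <- t) (width u)%:R^-1 <= q ^+ k * (2 * d%:R) :> R.
Proof.
have q0 := decay_gt0.
have w0 u : (0 : R) <= (width u)%:R^-1 by rewrite invr_ge0.
apply: (@le_trans _ _ (q ^+ k *
   (walk_sum o (fun u => (width u)%:R^-1 * (if (outdeg o u < indeg o u)%N then q^-2 else 1)) k v v +
    walk_sum o (fun u => (width u)%:R^-1 * (if (outdeg o u < indeg o u)%N then 1 else q^-2)) k v v))).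
  rewrite /walk_sum -big_split /= mulr_sumr big_seq [leRHS]big_seq.
  apply: ler_sum => t; rewrite mem_walks => /andP[/eqP <- _]; exact: prod_width_le.
have c0 (b : bool) u : 0 <= (width u)%:R^-1 * (if b then q^-2 else 1).
  by rewrite mulr_ge0 //; case: b; rewrite // invr_ge0 exprn_ge0 // ltW.
have c1 u n : (n <= width u)%N -> (width u)%:R^-1 * 1 * n%:R <= 1 :> R.
  by move=> nw; rewrite mulr1 ler_pdivrMl ?ltr0n ?width_gt0 // mulr1 ler_nat.
apply: ler_wpM2l; first by rewrite exprn_ge0 // ltW.
have -> : 2 * d%:R = d%:R + d%:R :> R by ring.
apply: lerD.
  apply: (@le_trans _ _ (outdeg o v)%:R); last by rewrite ler_nat.
  apply: walk_sum_le_out.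
    by move=> u.
  move=> u; case: ifPn => lt; first by apply: width_decay; rewrite /width; lia.
  by apply: c1; rewrite /width; lia.
apply: (@le_trans _ _ (indeg o v)%:R); last by rewrite ler_nat.
apply: walk_sum_le_in.
  by move=> u; case: ifP => _; [exact: (c0 false) | exact: (c0 true)].
move=> u; case: ifPn => lt; first by apply: c1; rewrite /width; lia.
by apply: width_decay; have := @o_unbal u; rewrite /width; lia.
Qed.
End WalkDecay.

(** * Numerical estimates for the growth factor *)

Section Slack.
Variables (R : realFieldType) (d : nat).
Hypothesis d_gt0 : (0 < d)%N.

(** The constant gives [decay <= slack ^+ 4]. Of the four powers, one pays for the reduced growth
    factor, one for the doubled weights, one for the factor [k] in the sum over lengths, and one is
    summed as a geometric series. *)
Definition slack : R := 1 - (8 * d%:R)^-1.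
Local Notation y := slack.

Let d_ge1 : (1 : R) <= d%:R. Proof. by rewrite ler1n. Qed.

Lemma slack_gt0 : 0 < y.
Proof. by rewrite /y subr_gt0 invf_lt1; move: d_ge1; lra. Qed.

Lemma slack_le1 : y <= 1.
Proof. by rewrite /y gerBl invr_ge0; move: d_ge1; lra. Qed.

(** Bernoulli's inequality [y^-n >= 1 + n / (8 d)], cleared of denominators. *)
Lemma slack_bernoulli n : y ^+ n * (8 * d%:R + n%:R) <= 8 * d%:R.
Proof.
elim: n => [|n IH]; first by rewrite expr0 mul1r addr0.
apply: le_trans IH; rewrite exprSr -mulrA ler_pM2l ?exprn_gt0 ?slack_gt0 //.
rewrite -[n.+1%:R]natr1 /y; have := d_ge1; set D := 8 * d%:R => h.
have D0 : 0 < D by rewrite /D; lra.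
have n0 : (0 : R) <= n%:R by [].
have : 1 <= D^-1 * (D + (n%:R + 1)) by rewrite ler_pdivlMl //; lra.
by rewrite mulrBl mul1r; move: (D^-1 * _) => X HX; lra.
Qed.

Lemma slack_half : y ^+ (8 * d) <= 2^-1.
Proof.
have := slack_bernoulli (8 * d); rewrite natrM; have := d_ge1.
set D := 8 * d%:R; set z := y ^+ _ => h H.
have D0 : 0 < D by rewrite /D; lra.
by rewrite -(ler_pM2r D0); lra.
Qed.

Lemma mulrn_slack k : k%:R * y ^+ k <= 8 * d%:R.
Proof.
have := slack_bernoulli k; have := d_ge1; have : 0 <= y ^+ k by rewrite exprn_ge0 // ltW ?slack_gt0.
set z := y ^+ _ => z0 h H.
have : 0 <= z * (8 * d%:R) by rewrite mulr_ge0 //; lra.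
by move: H; rewrite mulrDr mulrC; lra.
Qed.

Lemma decay_slack : decay R d <= y ^+ 4.
Proof.
rewrite /decay /slack !invfM; have : 0 < (d%:R : R)^-1 <= 1.
  by rewrite invr_gt0 invf_le1; move: d_ge1; lra.
set x := _^-1 => /andP[x0 x1].
have -> : (1 - 8^-1 * x) ^+ 4 = ((1 - 8^-1 * x) ^+ 2) ^+ 2 by rewrite -exprM.
nra.
Qed.

Lemma pow2_slack c k : (8 * d * c <= k)%N -> 2 ^+ c <= (y ^+ k)^-1.
Proof.
move=> ck; rewrite -[leLHS]invrK lef_pV2 ?posrE ?invr_gt0 ?exprn_gt0 ?slack_gt0 //.
apply: (@le_trans _ _ (y ^+ (8 * d * c))).
  by apply: ler_wiXn2l; [exact: ltW slack_gt0 | exact: slack_le1 |].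
rewrite exprM -exprVn; apply: lerXn2r; rewrite ?nnegrE ?slack_half ?invr_ge0 //.
by rewrite exprn_ge0 // ltW // slack_gt0.
Qed.

Lemma sum_slack p n : (1000 * d ^ 2 <= p)%N ->
  \sum_(k <- iota p n) k%:R * (2 * d%:R ^+ 2) * y ^+ (2 * k) <= 1 - y.
Proof.
move=> hp; have y0 := slack_gt0; have d1 := d_ge1.
have geo : \sum_(k <- iota p n) y ^+ k <= 8 * d%:R * y ^+ p.
  elim: n p {hp} => [|n IH] p /=.
    by rewrite big_nil !mulr_ge0 // exprn_ge0 // ltW.
  rewrite big_cons; apply: le_trans (lerD (lexx _) (IH p.+1)) _; rewrite exprS.
  have -> : 8 * d%:R * (y * y ^+ p) = 8 * d%:R * y ^+ p - y ^+ p; last by lra.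
  rewrite /y; field; by rewrite gt_eqF //; lra.
apply: (@le_trans _ _ (16 * d%:R ^+ 3 * \sum_(k <- iota p n) y ^+ k)).
  rewrite mulr_sumr; apply: ler_sum => k _.
  rewrite mul2n -addnn exprD mulrA; apply: ler_wpM2r; first by rewrite exprn_ge0 // ltW.
  have := mulrn_slack k; set a := k%:R; set b := y ^+ k => ab.
  have d2 : (0 : R) <= 2 * d%:R ^+ 2 by rewrite mulr_ge0 ?exprn_ge0 ?ler0n.
  have := ler_wpM2l d2 ab.
  have -> : 2 * d%:R ^+ 2 * (8 * d%:R) = 16 * d%:R ^+ 3 :> R by ring.
  by rewrite [X in X <= _ -> _]mulrCA -(mulrA a).
apply: (@le_trans _ _ (16 * d%:R ^+ 3 * (8 * d%:R * y ^+ p))).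
  by apply: ler_wpM2l geo; rewrite mulr_ge0 ?exprn_ge0.
(* What remains is [1024 * d^5 * y^p <= 1]. The exponent covers [1024 <= 2^11] and [d^5 <= 2^(5 d)];
   since [p >= 8 d (11 + 5 d)], the power [y^p] contains that many halvings. *)
have yp : y ^+ p <= (2 ^+ (11 + 5 * d))^-1.
  apply: (@le_trans _ _ (y ^+ (8 * d * (11 + 5 * d)))).
    by apply: ler_wiXn2l; [exact: ltW | exact: slack_le1 | nia].
  rewrite -[leLHS]invrK lef_pV2 ?posrE ?invr_gt0 ?exprn_gt0 //.
  exact: pow2_slack.
have d2d : d%:R ^+ 5 <= 2 ^+ (5 * d) :> R.
  rewrite mulnC exprM; apply: lerXn2r; rewrite ?nnegrE ?exprn_ge0 //.
  by rewrite -natrX ler_nat ltnW // ltn_expl.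
have -> : 1 - y = (8 * d%:R)^-1 by rewrite /y opprB addrC subrK.
rewrite -[leRHS]mul1r ler_pdivlMr; last by lra.
have -> : 16 * d%:R ^+ 3 * (8 * d%:R * y ^+ p) * (8 * d%:R) = 1024 * d%:R ^+ 5 * y ^+ p by ring.
apply: (@le_trans _ _ (1024 * 2 ^+ (5 * d) * (2 ^+ (11 + 5 * d))^-1)).
  have c0 : (0 : R) <= 1024 by exact: ler0n.
  apply: ler_pM; last exact: yp.
  - by apply: (mulr_ge0 c0); apply: exprn_ge0; exact: ler0n.
  - by apply: exprn_ge0; exact: ltW.
  - exact: ler_wpM2l.
have pow0 k : (0 : R) < 2 ^+ k by apply: exprn_gt0; exact: ltr0n.
by rewrite ler_pdivrMr ?pow0 // mul1r exprD ler_pM2r ?pow0 // -natrX ler_nat.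
Qed.
End Slack.

(** * Shifts that follow no long cycle *)

Section Events.
Variables (R : realFieldType) (T : finType) (o : rel T) (d p : nat).
Hypothesis d_gt0 : (0 < d)%N.
Hypothesis p_ge : (1000 * d ^ 2 <= p)%N.
Hypothesis out_le : forall v, (outdeg o v <= d)%N.
Hypothesis in_le : forall v, (indeg o v <= d)%N.
Hypothesis o_unbal : forall v, outdeg o v <> indeg o v.
Variables (A : T -> {set 'I_d.+1}) (F : {set T}) (value : seq T -> T -> 'I_d.+1).
Hypothesis value_rot : forall c n, uniq c -> value (rot n c) =1 value c.
Hypothesis A_gt0 : forall v, (0 < #|A v|)%N.
Hypothesis A_le : forall v, (#|A v| <= d)%N.
Hypothesis A_width : forall v, (width o v <= #|A v| * (if v \in F then 2 else 1))%N.
(** On a long path at most one vertex in [8 d] has doubled weight, so that all doublings together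
    cost at most one factor [y^-1] per vertex. *)
Hypothesis count_F : forall v t, uniq (v :: t) -> path o v t -> (p <= size t)%N ->
  (8 * d * count (mem F) t <= size t)%N.

Local Notation y := (slack R d).

(* The pair [(c, x)] stands for the event that all transitions of the directed
   cycle [c] are followed except possibly the one at [x]. *)
Definition cycle_supp (i : seq T * T) : {set T} := [set u in i.1] :\ i.2.

Definition closed_paths v k := [seq t <- walks o k v v | uniq (v :: t)].

(** Cycles are rotated to start at [v] and the exempted vertex is one of the others, so [v] lies in
    every support. With at least [p] vertices besides [v], the length exceeds [p]. *)
Definition long_cycles v : seq (seq T * T) :=
  [seq (v :: t, x) | t <- flatten [seq closed_paths v k | k <- iota p #|T|], x <- t].

Lemma mem_long_cycles v c x : ((c, x) \in long_cycles v) =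
  [&& ohead c == Some v, uniq c, cycle o c, (p < size c)%N, x \in c & x != v].
Proof.
apply/allpairsPdep/and5P.
  case=> t [x' [/flatten_mapP[k]]]; rewrite mem_iota => /andP[pk _].
  rewrite mem_filter mem_walks => /and3P[U /eqP sk pt] xt [-> ->].
  split=> //; first by rewrite /= sk ltnS.
  rewrite inE xt orbT /=; apply: contraTneq xt => ->.
  by move: U => /= /andP[].
case: c => [[]//|a t [/eqP[->] U cy sz /andP[xt xv]]].
exists t, x; split=> //; last by move: xt; rewrite inE (negbTE xv).
apply/flatten_mapP; exists (size t); last by rewrite mem_filter mem_walks eqxx U; exact: cy.
have := uniq_leq_size U (s2 := enum T); rewrite -cardT /= => h.
have st : (size t < #|T|)%N by apply: h => z _; rewrite mem_enum.
rewrite mem_iota; apply/andP; split; first exact: sz.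
exact: leq_trans st (leq_addl _ _).
Qed.

Definition beta v : R := y * #|A v|%:R.

Lemma beta_gt0 v : 0 < beta v.
Proof. by rewrite mulr_gt0 ?slack_gt0 // ltr0n. Qed.

Lemma beta_le_d v : beta v <= d%:R.
Proof.
apply: (@le_trans _ _ (1 * d%:R)); last by rewrite mul1r.
by apply: ler_pM; rewrite ?slack_le1 ?ler_nat // ltW // slack_gt0.
Qed.

Lemma betaV_le v :
  (beta v)^-1 <= y^-1 * ((width o v)%:R^-1 * (if v \in F then 2 else 1)).
Proof.
rewrite /beta invfM; apply: ler_wpM2l; first by rewrite invr_ge0 ltW // slack_gt0.
have w0 : (0 : R) < (width o v)%:R by rewrite ltr0n width_gt0.
have a0 : (0 : R) < #|A v|%:R by rewrite ltr0n.
rewrite -[leLHS]mul1r ler_pdivrMr // -mulrA ler_pdivlMl // mulr1 mulrC.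
by have := A_width v; case: ifP => _; rewrite -(ler_nat R) natrM.
Qed.

Lemma prod_betaV_le v t : uniq (v :: t) -> path o v t -> (p <= size t)%N ->
  \prod_(u <- t) (beta u)^-1 <= (y ^+ (2 * size t))^-1 * \prod_(u <- t) (width o u)%:R^-1.
Proof.
move=> U pt pk; have y0 : 0 < y := slack_gt0 R d_gt0.
apply: (@le_trans _ _ (\prod_(u <- t)
  (y^-1 * ((width o u)%:R^-1 * (if u \in F then 2 else 1))))).
  by apply: ler_prod => u _; rewrite invr_ge0 ltW ?beta_gt0 //= betaV_le.
rewrite !big_split /= big_const_seq count_predT iter_mulr_1 exprVn mul2n -addnn exprD invfM.
rewrite -mulrA; apply: ler_wpM2l; first by rewrite invr_ge0 exprn_ge0 // ltW.
rewrite mulrC; apply: ler_wpM2r; first by apply: prodr_ge0 => u _; rewrite invr_ge0.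
rewrite -big_mkcond /= big_const_seq iter_mulr_1; apply: pow2_slack => //.
exact: count_F U pt pk.
Qed.

(** The product on the left lacks the factor of the exempted vertex [x]; restoring it costs
    [beta x <= d]. *)
Lemma supp_prod_le v t x : uniq (v :: t) -> x \in t ->
  \prod_(u in cycle_supp (v :: t, x) :\ v) (beta u)^-1 <= d%:R * \prod_(u <- t) (beta u)^-1.
Proof.
move=> U xt; have /andP[vt Ut] := U.
have -> : cycle_supp (v :: t, x) :\ v = [set u in t] :\ x.
  apply/setP => u; rewrite !inE /=; case: eqP => [->|] //=.
  by rewrite (negbTE vt) andbF.
have -> : \prod_(u <- t) (beta u)^-1 = \prod_(u in [set u in t]) (beta u)^-1.
  by rewrite big_uniq //; apply: eq_bigl => u; rewrite inE.
rewrite [X in _ <= _ * X](big_setD1 x) ?inE //= mulrA ler_peMl //.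
  by apply: prodr_ge0 => u _; rewrite invr_ge0 ltW // beta_gt0.
by rewrite ler_pdivlMr ?beta_gt0 // mul1r beta_le_d.
Qed.

(** For each [k], there are [k] exempted vertices to choose, one factor [d] comes from
    [supp_prod_le], and [2 d] from the closed walks. *)
Lemma long_cycles_sum v :
  \sum_(i <- long_cycles v) \prod_(u in cycle_supp i :\ v) (beta u)^-1 <= 1 - y.
Proof.
have y0 : 0 < y := slack_gt0 R d_gt0.
apply: le_trans (sum_slack R d_gt0 #|T| p_ge).
rewrite big_allpairs_dep /= big_flatten big_map /=.
rewrite big_seq [leRHS]big_seq; apply: ler_sum => k; rewrite mem_iota => /andP[pk _].
apply: (@le_trans _ _ (\sum_(t <- closed_paths v k)
   k%:R * d%:R * (y ^+ (2 * k))^-1 * \prod_(u <- t) (width o u)%:R^-1)).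
  rewrite big_seq [leRHS]big_seq; apply: ler_sum => t.
  rewrite mem_filter mem_walks => /and3P[U /eqP sk]; rewrite rcons_path => /andP[pt _].
  apply: (@le_trans _ _ (\sum_(x <- t) d%:R * ((y ^+ (2 * k))^-1 * \prod_(u <- t) (width o u)%:R^-1))).
    rewrite [leLHS]big_seq [leRHS]big_seq; apply: ler_sum => x xt.
    apply: le_trans (supp_prod_le U xt) _; apply: ler_wpM2l => //.
    by rewrite -sk in pk *; exact: prod_betaV_le U pt pk.
  by rewrite big_const_seq count_predT sk iter_addr_0 -[_ *+ k]mulr_natl !mulrA.
rewrite -mulr_sumr.
apply: (@le_trans _ _ (k%:R * d%:R * (y ^+ (2 * k))^-1 * (decay R d ^+ k * (2 * d%:R)))).
  apply: ler_wpM2l; first by rewrite !mulr_ge0 // invr_ge0 exprn_ge0 // ltW.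
  apply: le_trans (closed_walks_le R d_gt0 out_le in_le o_unbal k v).
  rewrite big_filter big_mkcond /=; apply: ler_sum => t _; case: ifP => // _.
  by apply: prodr_ge0 => u _; rewrite invr_ge0.
have : decay R d ^+ k <= y ^+ (2 * k) * y ^+ (2 * k).
  rewrite -exprD -mulnDl exprM; apply: lerXn2r; rewrite ?nnegrE ?exprn_ge0 ?decay_slack //.
    exact: ltW (decay_gt0 R d_gt0).
  exact: ltW.
have : 0 < y ^+ (2 * k) by rewrite exprn_gt0.
move: (y ^+ (2 * k)) (decay R d ^+ k) => z c z0 cz.
rewrite -!mulrA ler_wpM2l //.
have -> : d%:R * (z^-1 * (c * (2 * d%:R))) = 2 * (d%:R * (d%:R * (z^-1 * c))) by ring.
by do 3 (apply: ler_wpM2l => //); rewrite ler_pdivrMl.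
Qed.

Lemma exists_shifts : exists w : {ffun T -> 'I_d.+1}, (forall v, w v \in A v) /\
  (forall c x, uniq c -> cycle o c -> (p < size c)%N -> x \in c ->
    exists u, [/\ u \in c, u != x & w u != value c u]).
Proof.
have [||||w [wA wE]] := @exists_avoiding R T d _ A cycle_supp (fun i => value i.1) long_cycles beta.
- exact: beta_gt0.
- move=> v [c x]; rewrite mem_long_cycles => /and5P[hc _ _ _ /andP[xc xv]].
  by case: c hc xc => // a c /eqP[->] _; rewrite !inE eq_sym xv eqxx.
- move=> v u [c x]; rewrite mem_long_cycles => /and5P[hc U cy sz /andP[xc xv]].
  rewrite !inE /= => /andP[ux uc]; have [n c' rc] := rot_to uc.
  exists (rot n c, x); split => /=.
  - rewrite mem_long_cycles rot_uniq rot_cycle size_rot mem_rot rc eqxx U cy sz xc /=.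
    by rewrite eq_sym.
  - by apply/setP => z; rewrite !inE mem_rot.
  - by move=> z _; rewrite value_rot.
- move=> v; have := long_cycles_sum v; set s := \sum_(i <- _) _.
  have y1 := slack_le1 R d_gt0; have y0 := slack_gt0 R d_gt0.
  have a1 : (1 : R) <= #|A v|%:R by rewrite ler1n.
  (* As [#|A v| >= 1], the total weight [1 - y] fits into the gap between [beta v] and [#|A v|]. *)
  rewrite /beta => hs; have : (1 - y) * 1 <= (1 - y) * #|A v|%:R by apply: ler_wpM2l => //; lra.
  by rewrite mulrBl; lra.
exists w; split=> // c x U cy sz xc.
have p1 : (1 <= p)%N by nia.
(* The event [(c, x)] is listed only at vertices other than [x], so one of these must serve as the
   start of the cycle. *)
have [v vc vx] : exists2 v, v \in c & v != x.
  case: c {cy xc} U sz => [//|a [|b c]] U sz; first by move: sz => /=; lia.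
  case: (eqVneq a x) => [ax|]; last by exists a; rewrite ?inE ?eqxx.
  exists b; first by rewrite !inE eqxx orbT.
  by move: U; rewrite /= inE ax negb_or eq_sym => /andP[/andP[]].
have [n c' rc] := rot_to vc.
have [|u] := wE v (rot n c, x).
  rewrite mem_long_cycles rot_uniq rot_cycle size_rot mem_rot rc eqxx U cy sz xc /=.
  by rewrite eq_sym.
rewrite !inE /= mem_rot value_rot // => /andP[ux uc] wu; by exists u.
Qed.
End Events.

(** * Short cycles on long paths *)

Section Windows.
Variables (T : finType) (e : rel T) (CC : {set {set {set T}}}) (N : nat).
Let marked : {set T} := \bigcup_(C in CC) vertices_of_cycle C.
Hypothesis disj : forall C C', C \in CC -> C' \in CC -> C <> C' ->
  vertices_of_cycle C :&: vertices_of_cycle C' = set0.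
Hypothesis far : forall u q, u \in marked -> last u q \in marked -> u <> last u q ->
  path (delete_cycles e CC) u q -> uniq (u :: q) -> (N < size q)%N.

Lemma cycle_eq C C' u : C \in CC -> C' \in CC ->
  u \in vertices_of_cycle C -> u \in vertices_of_cycle C' -> C = C'.
Proof.
move=> hC hC' uC uC'; apply/eqP; apply: contraT => /eqP ne.
by have /setP /(_ u) := disj hC hC' ne; rewrite !inE uC uC'.
Qed.

Lemma short_edge x y : [set x; y] \in cover CC ->
  exists C, [/\ C \in CC, x \in vertices_of_cycle C & y \in vertices_of_cycle C].
Proof.
case/bigcupP => C hC xyC; exists C; split=> //; apply/bigcupP; exists [set x; y] => //.
  exact: set21.
exact: set22.
Qed.

Lemma markedP x : reflect (exists2 C, C \in CC & x \in vertices_of_cycle C) (x \in marked).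
Proof. exact: bigcupP. Qed.

(** Both ends of a deleted edge are marked, so a path with unmarked interior can use one only if it
    consists of that single edge. *)
Lemma path_delete u q w : path e u (rcons q w) -> all (fun x => x \notin marked) q ->
  q != [::] \/ [set u; w] \notin cover CC -> path (delete_cycles e CC) u (rcons q w).
Proof.
have nmark a b : (a \notin marked) || (b \notin marked) -> [set a; b] \notin cover CC.
  apply: contraL => /short_edge[C [hC aC bC]]; rewrite negb_or !negbK.
  by apply/andP; split; apply/markedP; exists C.
elim: q u => [|y q IH] u /=.
  by rewrite /delete_cycles /= => /andP[-> _] _ [|->].
move=> /andP[euy pq] /andP[ny nq] _; rewrite {1}/delete_cycles /= euy nmark ?ny ?orbT //=.
by apply: IH => //; right; rewrite nmark ?ny.
Qed.

(** Consider the next marked vertex on the path. Either it is reached by an edge of a short cycle,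
    which is [C] by disjointness, or the piece avoids deleted edges and [far] makes it too long.
    Iterate from there. *)
Lemma last_same_cycle C u q : C \in CC -> u \in vertices_of_cycle C ->
  path e u q -> uniq (u :: q) -> (size q <= N)%N -> last u q \in marked ->
  last u q \in vertices_of_cycle C.
Proof.
move=> hC; elim: {q}(size q) {-2}q (leqnn (size q)) u => [|n IH] q sq u uC.
  by case: q sq.
move=> pq Uq qN lm; case: (boolP (has (mem marked) q)) => [hm|hm]; last first.
  case: q {sq pq Uq qN} lm hm => // y q lm /hasPn /(_ (last y q) (mem_last y q)) /negP.
  by case.
case: (split_find hm) pq Uq sq qN lm => w q1 q2 wm nq1.
rewrite cat_rcons => pq Uq sq qN lm; move: pq; rewrite cat_path /= => /and3P[pq1 elw pq2].
have {}nq1 : all (fun x => x \notin marked) q1 by rewrite all_predC.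
have wC : w \in vertices_of_cycle C.
  case: (boolP ((q1 == [::]) && ([set u; w] \in cover CC))) => [/andP[_ uw]|nuw].
    have [C' [hC' uC' wC']] := short_edge uw.
    by rewrite (cycle_eq hC hC' uC uC').
  have um : u \in marked by apply/markedP; exists C.
  have pd : path (delete_cycles e CC) u (rcons q1 w).
    apply: path_delete; rewrite ?rcons_path ?pq1 //.
    by move: nuw; rewrite negb_and => /orP.
  have U1 : uniq (u :: rcons q1 w).
    by move: Uq; rewrite -cat_rcons -cat_cons cat_uniq => /and3P[].
  have := @far u (rcons q1 w) um; rewrite last_rcons => /(_ wm).
  have uw : u <> w by move=> uw; move: U1; rewrite /= uw mem_rcons inE eqxx.
  move/(_ uw pd U1); rewrite size_rcons ltnNge => /negP; case.
  by apply: leq_trans qN; rewrite size_cat /= addnS ltnS leq_addr.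
rewrite last_cat /=; apply: IH => //.
- by move: sq; rewrite size_cat /= addnS ltnS; apply: leq_trans; rewrite leq_addl.
- by move: Uq; rewrite -cat_cons cat_uniq => /and3P[].
- by apply: leq_trans qN; rewrite size_cat /= addnS ltnW // ltnS leq_addl.
- by move: lm; rewrite last_cat.
Qed.

Variable F : {set T}.
Hypothesis F_marked : F \subset marked.
Hypothesis F_le2 : forall C, C \in CC -> (#|F :&: vertices_of_cycle C| <= 2)%N.

(** A window of [N + 1] vertices has [N] edges, so all vertices of [F] after the first one lie on
    the same short cycle as it. *)
Lemma count_window t : sorted e t -> uniq t -> (size t <= N.+1)%N ->
  (count (mem F) t <= 2)%N.
Proof.
move=> st Ut tN; case: (boolP (has (mem F) t)) => [hm|]; last by rewrite has_count -leqNgt leqn0 => /eqP ->.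
case: (split_find hm) st Ut tN => w t1 t2 wF nt1; rewrite cat_rcons => st Ut tN.
rewrite count_cat; have -> : count (mem F) t1 = 0%N by apply/eqP; rewrite -leqn0 leqNgt -has_count.
have pt2 : path e w t2 by case: t1 st {Ut tN nt1} => [|x t1] //=; rewrite cat_path /= => /and3P[].
have U2 : uniq (w :: t2) by move: Ut; rewrite cat_uniq => /and3P[].
have /markedP[C hC wC] := subsetP F_marked w wF.
rewrite add0n -size_filter -(card_uniqP (filter_uniq _ U2)).
apply: leq_trans (F_le2 hC); apply: subset_leq_card; apply/subsetP => x.
rewrite mem_filter => /andP[/= xF xt]; rewrite in_setI xF /=.
move: xt; rewrite inE => /orP[/eqP -> //|xt].
have xm := subsetP F_marked x xF.
case: (splitPr xt) pt2 U2 tN => t3 t4; rewrite -cat_rcons cat_path => /andP[p3 _] U2.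
rewrite !size_cat /= size_cat size_rcons => tN.
have := @last_same_cycle C w (rcons t3 x) hC wC p3; rewrite last_rcons; apply => //.
  by move: U2; rewrite -cat_cons cat_uniq => /and3P[].
by rewrite size_rcons; move: tN; clear; lia.
Qed.

Lemma count_path t : sorted e t -> uniq t ->
  (count (mem F) t <= 2 * (size t %/ N.+1).+1)%N.
Proof.
elim: {t}(size t) {-2}t (leqnn (size t)) => [|n IH] t st so Ut.
  by case: t st {so Ut}.
case: (leqP (size t) N.+1) => h.
  by apply: leq_trans (count_window so Ut h) _; rewrite mulnS leq_addr.
rewrite -{1}(cat_take_drop N.+1 t) count_cat.
have h1 : (count (mem F) (take N.+1 t) <= 2)%N.
  by apply: count_window; rewrite ?take_sorted ?take_uniq // size_take h.
have := IH (drop N.+1 t); rewrite size_drop => h2.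
have {h2} : (count (mem F) (drop N.+1 t) <= 2 * ((size t - N.+1) %/ N.+1).+1)%N.
  apply: h2; rewrite ?drop_sorted ?drop_uniq //.
  by move: st; clear; lia.
have -> : (size t %/ N.+1 = ((size t - N.+1) %/ N.+1).+1)%N.
  by rewrite -{1}(subnK (ltnW h)) divnDr ?dvdnn // divnn addn1.
by move: h1; clear; lia.
Qed.
End Windows.

Local Open Scope nat_scope.

(** * Cyclic shifts *)

Section Shifts.
Variables (T : finType) (o : rel T).

Definition in_rank x v := index x (enum [set w | o w v]).
Definition out_rank v y := index y (enum [set w | o v w]).

(* Subtracting the in-rank before reducing would truncate, hence the added width. *)
Definition shift x v y := (out_rank v y + width o v - in_rank x v) %% width o v.

Lemma in_rank_lt x v : o x v -> in_rank x v < indeg o v.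
Proof. by move=> ov; rewrite /indeg cardE index_mem mem_enum inE. Qed.

Lemma out_rank_lt v y : o v y -> out_rank v y < outdeg o v.
Proof. by move=> ov; rewrite /outdeg cardE index_mem mem_enum inE. Qed.

Lemma in_rank_width x v : o x v -> in_rank x v < width o v.
Proof. by move=> /in_rank_lt h; apply: leq_trans h (leq_maxr _ _). Qed.

Lemma out_rank_width v y : o v y -> out_rank v y < width o v.
Proof. by move=> /out_rank_lt h; apply: leq_trans h (leq_maxl _ _). Qed.

Lemma in_rank_inj x x' v : o x v -> o x' v -> in_rank x v = in_rank x' v -> x = x'.
Proof. 
by move=> ox ox'; have := @index_inj _ x (enum [set w | o w v]) x x'; rewrite !mem_enum !inE; apply.
 Qed.

Lemma out_rank_inj v y y' : o v y -> o v y' -> out_rank v y = out_rank v y' -> y = y'.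
Proof. 
by move=> oy oy'; have := @index_inj _ y (enum [set w | o v w]) y y'; rewrite !mem_enum !inE; apply.
 Qed.

Lemma shift_eq i j W s : i < W -> j < W -> s < W ->
  (s == (j + W - i) %% W) = ((i + s) %% W == j).
Proof.
move=> iW jW sW.
have -> : (j + W - i) %% W = if i <= j then j - i else j + W - i.
  case: leqP => h; last by rewrite modn_small //; lia.
  by rewrite addnC -addnBA // modnDl modn_small //; lia.
have -> : (i + s) %% W = if i + s < W then i + s else i + s - W.
  case: ltnP => h; first by rewrite modn_small.
  by rewrite -{1}(subnK h) modnDr modn_small //; lia.
by case: leqP => h1; case: ltnP => h2; apply/eqP/eqP; lia.
Qed.

Variable w : T -> nat.
Hypothesis w_lt : forall v, w v < width o v.

Definition link x v y := [&& o x v, o v y & w v == shift x v y].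

Lemma linkE x v y : o x v -> o v y ->
  link x v y = ((in_rank x v + w v) %% width o v == out_rank v y).
Proof.
move=> ox oy; rewrite /link ox oy /= /shift shift_eq ?in_rank_width ?out_rank_width //.
Qed.

Lemma link_o x v y : link x v y -> o x v /\ o v y.
Proof. by case/and3P. Qed.

Lemma link_fun x v y y' : link x v y -> link x v y' -> y = y'.
Proof.
move=> l l'; have [ox oy] := link_o l; have [_ oy'] := link_o l'.
move: l l'; rewrite !linkE // => /eqP e /eqP e'.
by apply: (out_rank_inj oy oy'); rewrite -e -e'.
Qed.

Lemma link_inj x x' v y : link x v y -> link x' v y -> x = x'.
Proof.
move=> l l'; have [ox oy] := link_o l; have [ox' _] := link_o l'.
move: l l'; rewrite !linkE // => /eqP <-; rewrite eqn_modDr !modn_small ?in_rank_width //.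
by move=> /eqP e; apply: (in_rank_inj ox ox').
Qed.

(** Here the width is the out-degree, so every residue is the rank of an out-arc; [link_in] is the
    dual case. *)
Lemma link_out v x : indeg o v < outdeg o v -> o x v -> exists y, link x v y.
Proof.
move=> lt ox; have W : width o v = outdeg o v by apply/maxn_idPl; exact: ltnW.
have jl : (in_rank x v + w v) %% width o v < size (enum [set y | o v y]).
  by rewrite -cardE -/(outdeg o v) -W ltn_pmod //; apply: leq_ltn_trans (w_lt v).
pose y := nth v (enum [set y | o v y]) ((in_rank x v + w v) %% width o v).
have oy : o v y by have := mem_nth v jl; rewrite mem_enum inE.
by exists y; rewrite linkE // /out_rank index_uniq // enum_uniq.
Qed.

Lemma link_in v y : outdeg o v < indeg o v -> o v y -> exists x, link x v y.
Proof.
move=> lt oy; have W : width o v = indeg o v by apply/maxn_idPr; exact: ltnW.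
have w0 : 0 < width o v by apply: leq_ltn_trans (w_lt v).
set i := (out_rank v y + width o v - w v) %% width o v.
have il : i < size (enum [set y | o y v]).
  by rewrite -cardE -/(indeg o v) -W ltn_pmod.
pose x := nth v (enum [set y | o y v]) i.
have ox : o x v by have := mem_nth v il; rewrite mem_enum inE.
exists x; rewrite linkE // {1}/in_rank index_uniq // ?enum_uniq //.
by rewrite addnC -shift_eq ?out_rank_width // ltn_pmod.
Qed.

Lemma linked_nth z x y s i : linked link x y s -> i < size s ->
  link (nth z [:: x, y & s] i) (nth z [:: x, y & s] i.+1) (nth z [:: x, y & s] i.+2).
Proof.
elim: s x y i => // a s IH x y [|i] /andP[lxy l] //= si; exact: (IH y a i l si).
Qed.

Lemma linked_cycle x y s : uniq [:: x, y & s] -> linked link x y (rcons s x) ->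
  forall u, u \in y :: s -> link (prev [:: x, y & s] u) u (next [:: x, y & s] u).
Proof.
move=> U l u us; set c := [:: x, y & s].
have uc : u \in c by rewrite inE us orbT.
have ux : u != x by apply: contraTneq us => ->; case/andP: U.
have iu : index u (y :: s) < size (y :: s) by rewrite index_mem.
have e : index u c = (index u (y :: s)).+1 by rewrite /c /= eq_sym (negbTE ux).
have := linked_nth x l; rewrite size_rcons => /(_ _ iu).
rewrite -!rcons_cons -/c !nth_rcons.
have i2 : (index u (y :: s)).+1 < size c by exact: iu.
rewrite (ltnW i2) i2.
rewrite -[nth x c _.+1]/(nth x (y :: s) (index u (y :: s))) nth_index //.
rewrite next_nth prev_nth uc /c e -/c.
congr (link _ _ _).
(* Beyond the end, [nth] returns its default [x], the head of [c], which is the successor of the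
   last vertex. *)
rewrite -[RHS]/(nth x c (index u (y :: s)).+2).
by case: ltngtP => // h; rewrite nth_default // ?h // ltnW.
Qed.
End Shifts.

(** * Directed cycles and their edge sets *)

Section DirectedCycles.
Variables (T : finType) (o : rel T).
Hypothesis o_asym : forall u v, ~~ (o u v && o v u).

Lemma mem_edges_of_cycle (c : seq T) x : x \in c -> [set x; next c x] \in edges_of_cycle c.
Proof. by move=> xc; apply/imsetP; exists x. Qed.

Lemma mem_cover_edges (c : seq T) x : x \in vertices_of_cycle (edges_of_cycle c) = (x \in c).
Proof.
apply/bigcupP/idP => [[_ /imsetP[y yc ->]]|xc].
  by rewrite !inE => /orP[]/eqP-> //; rewrite mem_next.
by exists [set x; next c x]; [exact: mem_edges_of_cycle | rewrite !inE eqxx].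
Qed.

Lemma edges_of_cycle_mem (c c' : seq T) : edges_of_cycle c = edges_of_cycle c' -> c =i c'.
Proof. by move=> E x; rewrite -!mem_cover_edges E. Qed.

(** The edge set of a directed cycle fixes its direction: traversing an edge the other way would
    require both opposite arcs. *)
Lemma edges_of_cycle_next c c' x : cycle o c -> cycle o c' ->
  edges_of_cycle c = edges_of_cycle c' -> x \in c -> next c x = next c' x.
Proof.
move=> cy cy' E xc; have ox := next_cycle cy xc.
have := mem_edges_of_cycle xc; rewrite E => /imsetP[y yc' /setP e].
have oy := next_cycle cy' yc'.
have := e x; have := e (next c x); rewrite !inE !eqxx orbT /=.
move=> /esym /orP[]/eqP h1 /esym /orP[]/eqP h2.
- by have := o_asym x x; move: ox; rewrite h1 -h2 => ->.
- by have := o_asym x y; move: ox oy; rewrite h1 -h2 => -> ->.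
- by rewrite h1 h2.
- by have := o_asym x x; move: ox; rewrite h1 -h2 => ->.
Qed.

Lemma edges_of_cycle_prev c c' x : ucycle o c -> ucycle o c' ->
  edges_of_cycle c = edges_of_cycle c' -> x \in c -> prev c x = prev c' x.
Proof.
move=> /andP[cy U] /andP[cy' U'] E xc.
have pc : prev c x \in c by rewrite mem_prev.
have := edges_of_cycle_next cy cy' E pc; rewrite next_prev // => {2}->.
by rewrite prev_next.
Qed.

(* [[::]] when [C] does not come from a directed cycle. *)
Definition rep (C : {set {set T}}) : seq T :=
  classical_sets.xget [::] (fun c : seq T =>
    [/\ 3 <= size c, ucycle o c & C = edges_of_cycle c]).

Lemma repP C : rep C = [::] \/
  [/\ 3 <= size (rep C), ucycle o (rep C) & C = edges_of_cycle (rep C)].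
Proof. by rewrite {1}/rep; case: classical_sets.xgetP => [c -> Pc|]; [right|left]. Qed.

Lemma rep_cycle c : 3 <= size c -> ucycle o c ->
  [/\ 3 <= size (rep (edges_of_cycle c)), ucycle o (rep (edges_of_cycle c)) &
      edges_of_cycle c = edges_of_cycle (rep (edges_of_cycle c))].
Proof.
move=> sz uc; pose P c' := [/\ 3 <= size c', ucycle o c' & edges_of_cycle c = edges_of_cycle c'].
exact: (@classical_sets.xgetI _ [::] P c (And3 sz uc erefl)).
Qed.

Lemma rep_vertices C x : x \in rep C ->
  [/\ x \in vertices_of_cycle C, o (prev (rep C) x) x & o x (next (rep C) x)].
Proof.
case: (repP C) => [-> //|[_ /andP[cy U] E] xr]; split.
- by rewrite E mem_cover_edges.
- exact: prev_cycle cy xr.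
- exact: next_cycle cy xr.
Qed.
End DirectedCycles.

(** * Excluding shifts on short cycles and assembling the proof *)

Section Assembly.
Variables (T : finType) (e o : rel T) (d p : nat).
Let CC := short_cycles e p.
Hypothesis d_gt0 : 0 < d.
Hypothesis p_ge : 1000 * d ^ 2 <= p.
Hypothesis deg_le : max_degree e <= d.
Hypothesis disj : forall C C', C \in CC -> C' \in CC -> C <> C' ->
  vertices_of_cycle C :&: vertices_of_cycle C' = set0.
Hypothesis far : forall u q, u \in \bigcup_(C in CC) vertices_of_cycle C ->
  last u q \in \bigcup_(C in CC) vertices_of_cycle C -> u <> last u q ->
  path (delete_cycles e CC) u q -> uniq (u :: q) -> (32 * d).-1 < size q.
Hypothesis o_orient : orientation e o.
Hypothesis o_unbal : forall v, outdeg o v <> indeg o v.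

Let o_asym u v : ~~ (o u v && o v u). Proof. exact: o_orient.2. Qed.

Let o_e u v : o u v -> e u v. Proof. by rewrite o_orient.1 => ->. Qed.

Let degree_le v : #|[set w | e v w]| <= d.
Proof. apply: leq_trans deg_le; exact: (leq_bigmax (F := fun v => #|[set w | e v w]|)). Qed.

Lemma outdeg_le v : outdeg o v <= d.
Proof.
apply: leq_trans (degree_le v); apply: subset_leq_card; apply/subsetP => w.
by rewrite !inE; exact: o_e.
Qed.

Lemma indeg_le v : indeg o v <= d.
Proof.
apply: leq_trans (degree_le v); apply: subset_leq_card; apply/subsetP => w.
by rewrite !inE o_orient.1 => ->; rewrite orbT.
Qed.

Local Notation rep := (rep o).

Definition cycle_shift (c : seq T) u := shift o (prev c u) u (next c u).

(* At the first two vertices of a short directed cycle the shift following the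
   cycle is excluded; at least one of them differs from the exempted vertex. *)
Definition forbidden v s :=
  [exists C in CC, (v \in take 2 (rep C)) && (s == cycle_shift (rep C) v)].

Definition allowed v : {set 'I_d.+1} :=
  [set s : 'I_d.+1 | (s < width o v) && ~~ forbidden v s].

Definition restricted : {set T} := \bigcup_(C in CC) [set x in take 2 (rep C)].

Lemma restrictedP v : reflect (exists2 C, C \in CC & v \in take 2 (rep C)) (v \in restricted).
Proof.
by apply: (iffP bigcupP) => -[C hC vC]; exists C => //; move: vC; rewrite in_set.
Qed.

Lemma restricted_marked : restricted \subset \bigcup_(C in CC) vertices_of_cycle C.
Proof.
apply/subsetP => x /restrictedP[C hC /mem_take xr]; apply/bigcupP; exists C => //.
by have [] := rep_vertices xr.
Qed.

Lemma restricted_le2 C : C \in CC -> #|restricted :&: vertices_of_cycle C| <= 2.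
Proof.
move=> hC; apply: (@leq_trans #|[set x in take 2 (rep C)]|).
  apply: subset_leq_card; apply/subsetP => x; rewrite in_setI => /andP[/restrictedP[C' hC' xr] xC].
  have [xC' _ _] := rep_vertices (mem_take xr).
  by rewrite inE (cycle_eq disj hC hC' xC xC').
rewrite cardsE; apply: leq_trans (card_size _) _.
by rewrite size_take; case: ifP => // /negbT; rewrite -leqNgt.
Qed.

Lemma card_ord_lt W : W <= d -> #|[set s : 'I_d.+1 | s < W]| = W.
Proof.
move=> Wd; have Wd' : W <= d.+1 by exact: leqW.
have inj : injective (widen_ord Wd') by move=> i j /(congr1 val) h; apply: val_inj.
rewrite -[RHS]card_ord -(card_imset predT inj).
apply: eq_card => s; rewrite inE; apply/idP/imsetP => [sW|[i _ ->]]; last by case: i.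
by exists (Ordinal sW) => //; apply: val_inj.
Qed.

Lemma card_allowed_le v : #|allowed v| <= d.
Proof.
apply: leq_trans (width_le outdeg_le indeg_le v).
rewrite -[leqRHS](card_ord_lt (width_le outdeg_le indeg_le v)).
by apply: subset_leq_card; apply/subsetP => s; rewrite !inE => /andP[].
Qed.

(** A restricted vertex has an in-arc and an out-arc and is unbalanced, so its width is at least 2.
    It lies on only one short cycle, so one shift at most is lost, which leaves at least half of
    them. *)
Lemma card_allowed v :
  0 < #|allowed v| /\ width o v <= #|allowed v| * (if v \in restricted then 2 else 1).
Proof.
have Wd := width_le outdeg_le indeg_le v; have W0 := width_gt0 o_unbal v.
case: (boolP (v \in restricted)) => vR; last first.
  have -> : allowed v = [set s : 'I_d.+1 | s < width o v].
    apply/setP => s; rewrite !inE; case: (s < _) => //=.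
    apply/negP => /existsP[C /and3P[hC vC _]]; case/negP: vR.
    by apply/restrictedP; exists C.
  by rewrite card_ord_lt // muln1.
have [C hC vr] := restrictedP v vR; have [vC op on] := rep_vertices (mem_take vr).
have W2 : 1 < width o v.
  have i1 : 0 < indeg o v by apply/card_gt0P; exists (prev (rep C) v); rewrite inE.
  have o1 : 0 < outdeg o v by apply/card_gt0P; exists (next (rep C) v); rewrite inE.
  have := @o_unbal v; move: i1 o1; rewrite /width; clear; lia.
have sub : [set s : 'I_d.+1 | s < width o v] :\ inord (cycle_shift (rep C) v) \subset allowed v.
  apply/subsetP => s; rewrite !inE => /andP[ns ->] /=.
  apply/negP => /existsP[C' /and3P[hC' vr' /eqP e']]; case/negP: ns.
  have [vC' _ _] := rep_vertices (mem_take vr').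
  by rewrite (cycle_eq disj hC hC' vC vC') -e' inord_val.
have := subset_leq_card sub.
have := cardsD1 (inord (cycle_shift (rep C) v)) [set s : 'I_d.+1 | s < width o v].
rewrite card_ord_lt //; move: W2 => /=.
move: (width o v) #|_ :\ _| #|allowed v| (_ \in _) => a b c [] a2 ab bc; split; lia.
Qed.

Lemma count_restricted v t : uniq (v :: t) -> path o v t -> p <= size t ->
  8 * d * count (mem restricted) t <= size t.
Proof.
move=> U pt pk; have /andP[_ Ut] := U.
have st : sorted e t.
  case: t pt {U pk Ut} => //= x t /andP[_]; exact: sub_path.
have N1 : (32 * d).-1.+1 = 32 * d by rewrite prednK // muln_gt0 d_gt0.
have := count_path disj far restricted_marked restricted_le2 st Ut.
rewrite N1; have := leq_trunc_div (size t) (32 * d).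
move: (count _ _) (_ %/ _) => c m; move: (size t) pk => k pk mk cm.
(* From [c <= 2 (m + 1)] and [32 d m <= k] follows [8 d c <= k/2 + 16 d], and [k >= 32 d] absorbs
   the last term. *)
have k32 : 32 * d <= k by move: d_gt0 p_ge pk; clear; nia.
by move: mk cm k32; clear; nia.
Qed.

Lemma cycle_shift_lt c u : cycle_shift c u < width o u.
Proof. by rewrite ltn_mod (width_gt0 o_unbal). Qed.

Lemma cycle_shift_inord c u : (inord (cycle_shift c u) : 'I_d.+1) = cycle_shift c u :> nat.
Proof.
by rewrite inordK // ltnS (leq_trans (ltnW (cycle_shift_lt c u))) // (width_le outdeg_le indeg_le).
Qed.

Lemma short_cycle_allowed (w : {ffun T -> 'I_d.+1}) c x : (forall v, w v \in allowed v) ->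
  3 <= size c -> ucycle o c -> edges_of_cycle c \in CC ->
  exists u, [/\ u \in c, u != x & w u != cycle_shift c u :> nat].
Proof.
move=> wA sz uc hC; have [sr ur E] := rep_cycle sz uc.
set r := rep _ in sr ur E *.
have [u ut ux] : exists2 u, u \in take 2 r & u != x.
  case: r sr ur {E} => [|a [|b r]] // _ /andP[_ U].
  case: (eqVneq a x) => [ax|]; last by exists a; rewrite ?inE ?eqxx.
  exists b; first by rewrite /= take0 !inE eqxx orbT.
  by move: U; rewrite /= inE ax negb_or eq_sym => /andP[/andP[]].
have uinc : u \in c by rewrite (edges_of_cycle_mem E) (mem_take ut).
exists u; split=> //; have := wA u; rewrite inE => /andP[_]; apply: contra => /eqP wu.
apply/existsP; exists (edges_of_cycle c); rewrite hC -/r ut /= wu /cycle_shift.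
have /andP[cy _] := uc; have /andP[cy' _] := ur.
by rewrite (edges_of_cycle_next o_asym cy cy' E uinc) (edges_of_cycle_prev o_asym uc ur E uinc).
Qed.

Theorem far_cycles_consistent : consistent o.
Proof.
have [|||||w [wA wE]] := @exists_shifts rat T o d p d_gt0 p_ge outdeg_le indeg_le o_unbal
  allowed restricted (fun c u => inord (cycle_shift c u)).
- by move=> c n U u; rewrite /cycle_shift next_rot // prev_rot.
- by move=> v; case: (card_allowed v).
- exact: card_allowed_le.
- by move=> v; case: (card_allowed v).
- exact: count_restricted.
have w_lt v : w v < width o v by have := wA v; rewrite inE => /andP[].
have o_irr x : ~~ o x x by have := o_asym x x; rewrite andbb.
pose wn v : nat := w v.
refine (@linked_consistent T o (link o wn) o_irr (@link_o T o wn) (@link_fun T o wn w_lt)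
  (@link_inj T o wn w_lt) (@link_out T o wn w_lt) (@link_in T o wn w_lt) o_unbal _).
move=> x y s U oxy; apply/negP => l; set c := [:: x, y & s].
have lc := linked_cycle U l.
have cy : cycle o c.
  rewrite /c /= oxy /=; move: l; clear; move: (rcons s x) => s'.
  by elim: s' x y => //= z s' IH x y /andP[/link_o[_ ->] /IH].
have uc : ucycle o c by rewrite /ucycle cy.
have sz : 3 <= size c.
  case: s @c l {U lc cy uc} => //= /andP[/link_o[_ oyx] _].
  by have := o_asym x y; rewrite oxy oyx.
(* By [linked_cycle], [w] equals the shift of [c] at every vertex except perhaps [x]; one further
   vertex of disagreement refutes this. *)
suff [u [uinc ux /eqP]] : exists u, [/\ u \in c, u != x & w u != cycle_shift c u :> nat].
  case; have : u \in y :: s by move: uinc; rewrite /c in_cons (negbTE ux).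
  by move=> /lc /and3P[_ _ /eqP].
case: (boolP (edges_of_cycle c \in CC)) => [hC|nC]; first exact: short_cycle_allowed.
have [||||u [uinc ux wu]] := wE c x => //.
(* With at most [p] vertices the cycle has at most [p] edges and would be short. *)
- rewrite ltnNge; apply: contra nC => cp; rewrite inE; apply/andP; split.
    apply/asboolP; exists c; split=> //; rewrite /ucycle U andbT.
    by apply: sub_path cy; exact: o_e.
  by apply: leq_trans cp; apply: leq_trans (leq_imset_card _ _) (card_size _).
- by rewrite inE eqxx.
exists u; split=> //; apply: contra wu => /eqP wu; apply/eqP/val_inj => /=.
by rewrite wu cycle_shift_inord.
Qed.
End Assembly.

(** * The threshold for [n] and the conclusion *)

Lemma le_lnln (R : realType) (m : nat) : exists n0 : nat, forall n, n0 <= n ->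
  (m%:R <= ln (ln n%:R) :> R)%R.
Proof.
exists (Num.truncn (expR (expR m%:R) : R)%R).+1 => n hn.
have h : (expR (expR m%:R) <= n%:R :> R)%R.
  by apply: le_trans (ltW (truncnS_gt _)) _; rewrite ler_nat.
have h1 : (expR m%:R <= ln n%:R :> R)%R.
  rewrite -[leLHS]expRK ler_ln ?posrE ?expR_gt0 //.
  exact: lt_le_trans (expR_gt0 _) h.
rewrite -[leLHS]expRK ler_ln ?posrE ?expR_gt0 //.
exact: lt_le_trans (expR_gt0 _) h1.
Qed.

Theorem theorem4p8 (R : realType) (d p : nat)
    (hd : (2 <= d)%N) (hp : (1000 * d ^ 2 <= p)%N) :
  exists n0 : nat,
    forall (n : nat) (T : finType) (e : rel T),
      simple_graph e -> discrete R n d p e -> (n0 <= n)%N ->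
      forall o : rel T,
        orientation e o ->
        (forall v : T, outdeg o v <> indeg o v) ->
        consistent o.
Proof.
(* Once [log log n >= 32 d], a path between distinct vertices of short cycles that avoids the edges
   of these cycles has more than [32 d - 1] edges, hence does not fit into a window of [32 d]
   vertices. *)
have [n0 hn0] := le_lnln R (32 * d); exists n0 => n T e _ [_ deg _ disj far] hn o oe ou.
apply: (far_cycles_consistent _ hp deg disj _ oe ou); first exact: ltnW.
move=> u q um lm ne pq U.
have := far u _ um lm ne; move=> /le_trans /(_ _) h.
have : ((ln (ln (n%:R : R)))%:E <= ((size q)%:R)%:E)%E.
  by apply: h; apply: ereal_inf_lbound; exists q.
rewrite lee_fin => /(le_trans (hn0 n hn)); rewrite ler_nat.
by apply: leq_trans; rewrite prednK // muln_gt0 /=; exact: ltnW.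
Qed.
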